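(* Let $p\geq 2$ be a fixed integer. The average number of parts of a composition in $\mathrm{MI}_n^p$ satisfies, as $n\to\infty$, $$\frac{1}{|\mathrm{MI}_n^p|}\sum_{x\in \mathrm{MI}_n^p}\mathtt{parts}(x)\sim\left(1+\frac{2}{p}\right)\frac{n}{3},$$ where $\mathtt{parts}(x)=m$ for $x=(x_1,\ldots,x_m)$.
   Context: A composition of $n\ge 1$ is a tuple $(x_1,\ldots,x_m)$ of positive integers with $m\geq 1$ and $x_1+\cdots+x_m=n$. $\mathbb{F}_n^p$ is the set of compositions of $n$ all of whose parts satisfy $1\leq x_i\leq p$. It is ordered by the dominance order: $(x_1,\ldots,x_m)\leq (y_1,\ldots,y_\ell)$ iff $\sum_{i=1}^k x_i\leq\sum_{i=1}^k y_i$ for all $1\leq k\leq\min(m,\ell)$. With this order $\mathbb{F}_n^p$ is a finite distributive lattice. An element $y$ is an upper cover of $x$ if $x<y$ and $x\le z\le y$ implies $z\in\{x,y\}$. $\mathrm{MI}_n^p$ is the set of meet-irreducible elements of $\mathbb{F}_n^p$, i.e. the elements having exactly one upper cover in $\mathbb{F}_n^p$. *)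

(* Defs.v *)
From HB Require Import structures.
From mathcomp Require Import all_boot all_order.
From mathcomp Require Import zify.

Set Implicit Arguments.
Unset Strict Implicit.
Unset Printing Implicit Defensive.

Definition is_composition (n p : nat) (s : seq nat) : bool :=
  [&& 0 < size s, all (fun i => 0 < i <= p) s & sumn s == n].

Record composition (n p : nat) : Type := Composition {
  parts_seq :> seq nat;
  parts_seqP : is_composition n p parts_seq
}.

HB.instance Definition _ n p := [isSub for @parts_seq n p].
HB.instance Definition _ n p := [Countable of composition n p by <:].

(* A composition of n has at most n parts, hence the bounded sequences. *)
Definition bseq_of_composition n p (x : composition n p) : n.-bseq 'I_p.+1 :=
  insub_bseq n (map inord x).

Definition composition_of_bseq n p (b : n.-bseq 'I_p.+1) :
  option (composition n p) := insub (map val b).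

Lemma bseq_of_compositionK n p :
  pcancel (@bseq_of_composition n p) (@composition_of_bseq n p).
Proof.
case=> s Ps; rewrite /composition_of_bseq /bseq_of_composition /=.
have /and3P[_ s_parts /eqP s_sum] := Ps.
have size_s : size s <= n.
  rewrite -s_sum; elim: s s_parts {Ps s_sum} => //= a s IHs /andP[a_p /IHs].
  by lia.
rewrite /insub_bseq val_insubd size_map size_s -map_comp map_id_in ?insubT //.
by move=> i /(allP s_parts) /andP[_ i_p] /=; rewrite inordK.
Qed.

HB.instance Definition _ n p : isFinite (composition n p) :=
  PCanIsFinite (@bseq_of_compositionK n p).

Definition dominance n p (x y : composition n p) : bool :=
  all (fun k => sumn (take k x) <= sumn (take k y))
      (iota 1 (minn (size x) (size y))).

Lemma dominanceP n p (x y : composition n p) :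
  reflect (forall k, 1 <= k <= minn (size x) (size y) ->
             sumn (take k x) <= sumn (take k y))
          (dominance x y).
Proof.
apply: (iffP allP) => H k; last by rewrite mem_iota add1n ltnS => /H.
by move=> kP; apply: H; rewrite mem_iota add1n ltnS.
Qed.

Lemma sumn_take_leq n p (x : composition n p) k : sumn (take k x) <= n.
Proof.
have /and3P[_ _ /eqP x_sum] := parts_seqP x.
by rewrite -[leqRHS]x_sum -[in leqRHS](cat_take_drop k x) sumn_cat leq_addr.
Qed.

Lemma sumn_take_ltn n p (x : composition n p) k :
  k < size x -> sumn (take k x) < n.
Proof.
move=> k_x; have /and3P[_ /allP x_parts /eqP x_sum] := parts_seqP x.
rewrite -[ltnRHS]x_sum -[in ltnRHS](cat_take_drop k x) sumn_cat.
rewrite (drop_nth 0 k_x) /=.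
have /andP[nth_gt0 _] := x_parts _ (mem_nth 0 k_x).
by rewrite -[ltnLHS]addn0 ltn_add2l addn_gt0 nth_gt0.
Qed.

Lemma sumn_take_full n p (x : composition n p) k :
  size x <= k -> sumn (take k x) = n.
Proof.
by move=> x_k; have /and3P[_ _ /eqP] := parts_seqP x; rewrite take_oversize.
Qed.

Lemma dominanceE n p (x y : composition n p) :
  reflect (forall k, sumn (take k x) <= sumn (take k y)) (dominance x y).
Proof.
apply: (iffP (dominanceP x y)) => [H k | H k _]; last exact: H.
have full j : size y <= j -> sumn (take j x) <= sumn (take j y).
  by move=> /sumn_take_full ->; exact: sumn_take_leq.
have [/full //|k_y] := leqP (size y) k.
case: k k_y => [|k] k_y; first by rewrite !take0.
have [k_x|x_k] := leqP k.+1 (size x); first by apply: H; lia.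
have x_gt0 : 0 < size x by have /and3P[] := parts_seqP x.
have : sumn (take (size x) x) <= sumn (take (size x) y) by apply: H; lia.
rewrite sumn_take_full // leqNgt sumn_take_ltn //; lia.
Qed.

Lemma dominance_refl n p : reflexive (@dominance n p).
Proof. by move=> x; apply/dominanceE. Qed.

Lemma dominance_trans n p : transitive (@dominance n p).
Proof.
move=> y x z /dominanceE xy /dominanceE yz; apply/dominanceE => k.
exact: leq_trans (xy k) (yz k).
Qed.

Lemma dominance_anti n p : antisymmetric (@dominance n p).
Proof.
move=> x y /andP[/dominanceE xy /dominanceE yx].
have E k : sumn (take k x) = sumn (take k y) by apply/eqP; rewrite eqn_leq xy yx.
have le_size (u v : composition n p) :
    (forall k, sumn (take k u) = sumn (take k v)) -> size u <= size v.
  move=> uv; rewrite leqNgt; apply/negP => /sumn_take_ltn.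
  by rewrite uv sumn_take_full // ltnn.
have size_xy : size x = size y.
  by apply/eqP; rewrite eqn_leq !le_size // => k; rewrite E.
apply/val_inj/(@eq_from_nth _ 0) => //= i i_x.
have i_y : i < size y by rewrite -size_xy.
have := E i.+1; rewrite (take_nth 0 i_x) (take_nth 0 i_y) !sumn_rcons E.
by move/addnI.
Qed.

Fact composition_display : Order.disp_t. Proof. exact: Order.Disp tt tt. Qed.

HB.instance Definition _ n p :=
  Order.Le_isPOrder.Build composition_display (composition n p)
    (@dominance_refl n p) (@dominance_anti n p) (@dominance_trans n p).

Definition upper_cover n p (x y : composition n p) : bool :=
  (x < y)%O &&
  [forall z : composition n p, (x <= z <= y)%O ==> (z \in [set x; y])].

Definition MI (n p : nat) : {set composition n p} :=
  [set x | #|[set y | upper_cover x y]| == 1].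

Definition parts n p (x : composition n p) : nat := size x.

(* Main.v *)
Require Import Defs.
From mathcomp Require Import all_boot all_order all_algebra.
From mathcomp Require Import all_classical all_reals all_analysis.
From mathcomp Require Import zify ring lra.
Import Order.TTheory GRing.Theory Num.Theory.
Import numFieldNormedType.Exports.

Set Implicit Arguments.
Unset Strict Implicit.
Unset Printing Implicit Defensive.

(** Dominance is the pointwise order on partial sums, and an upper cover of [x] raises a single partial sum [x_1 + ... + x_k] by 1, which is possible iff [x_k < p] and either [x_(k+1) >= 2] or [k + 1] is the last index. Exactly one such [k] exists iff [x = p^a c 1^b p^d e] with [1 <= c < p] and [1 <= e <= p], and this form is unique. Fix [c] and [e], and put [N = n - c - e], [q = N %/ p]. Grouping by [s = a + d], there are [T = \sum_(s <= q) (s + 1)] such words, with [U = \sum_(s <= q) (s + 1) (s + (N - p s) + 2)] parts in total, and [3 U = (3 (N + 2) - 2 (p - 1) q) T]. Since [p q] and [N] differ from [n] by a bounded amount, the average [U / T] is within a bounded distance of [(1 + 2 / p) n / 3], uniformly in [c] and [e], hence so is the overall average. *)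

(** * Upper covers *)

(** Moves one unit from part [k + 1] to part [k], counted from 0. A part 1 then vanishes, which is
    meant for the last part only. *)
Fixpoint raise_seq k (s : seq nat) : seq nat :=
  match k, s with
  | 0, [:: a, b & s'] => a.+1 :: (if b == 1 then s' else b.-1 :: s')
  | k'.+1, a :: s' => a :: raise_seq k' s'
  | _, _ => s
  end.

(** The full sum, fixed at [n], is excluded by [k.+1 < size s]. A part 1 that is not last must not
    vanish, as later partial sums would rise too. *)
Definition raisable p (s : seq nat) k : bool :=
  [&& k.+1 < size s, nth 0 s k < p & (k.+2 == size s) || (1 < nth 0 s k.+1)].

Fixpoint num_raisable p (s : seq nat) : nat :=
  if s is a :: s' then
    raisable p s 0 + num_raisable p s'
  else 0.

Lemma sum_raisable p s N : size s <= N -> \sum_(k < N) raisable p s k = num_raisable p s.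
Proof.
elim: s N => [|a s IHs] [|N] //= sN; first by rewrite big_ord0.
  by rewrite big1.
by rewrite big_ord_recl -(IHs N).
Qed.

Lemma psum_raise_seq p s k j : all (leq 1) s -> raisable p s k ->
  sumn (take j (raise_seq k s)) = sumn (take j s) + (j == k.+1).
Proof.
elim: k s j => [|k IHk] [|a s] // j.
  case: s => [|b s] // /and3P[_ b_gt0 _] /and3P[_ _ /=].
  case: j => [|[|j]] /=; rewrite ?take0 /=; try lia.
  case: (b =P 1) => [->|_ _] /=; last lia.
  (* The vanishing part 1 is the last one, so both sequences reach the same total. *)
  by rewrite orbF !eqSS eq_sym size_eq0 => /eqP -> /=; lia.
by case: j => [|j] //= /andP[_ s_gt0] s_k; rewrite (IHk s j s_gt0 s_k) addnA.
Qed.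

Lemma is_composition_raise n p s k : raisable p s k -> is_composition n p s ->
  is_composition n p (raise_seq k s).
Proof.
move=> s_k /and3P[_ s_parts /eqP s_sum]; apply/and3P; split.
- by case: k s {s_parts s_sum} s_k => [|k] [|a [|b s]].
- elim: k s {s_sum} s_k s_parts => [|k IHk] [|a s] //; last first.
    by move=> s_k /= /andP[-> /(IHk s s_k)].
  case: s => [|b s] // /and3P[_ /= a_p _] /and3P[a0 b0 s_parts].
  by case: (b =P 1) => b1 /=; rewrite s_parts; lia.
- apply/eqP; rewrite -s_sum; elim: k s {s_sum} s_k s_parts => [|k IHk] [|a s] //.
    case: s => [|b s] // _ /= /and3P[_ /andP[b_gt0 _] _].
    by case: (b =P 1) => [->|_] /=; lia.
  by move=> s_k /= /andP[_ /(IHk s s_k)->].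
Qed.

(** The default [x] is never taken for a raisable [k]. *)
Definition raise n p (x : composition n p) k : composition n p :=
  insubd x (raise_seq k x).

Lemma composition_gt0 n p (x : composition n p) : all (leq 1) x.
Proof.
by have /and3P[_ /allP x_parts _] := parts_seqP x; apply/allP => i /x_parts/andP[].
Qed.

Lemma psum_raise n p (x : composition n p) k j : raisable p x k ->
  sumn (take j (raise x k)) = sumn (take j x) + (j == k.+1).
Proof.
move=> x_k; rewrite -(psum_raise_seq _ (composition_gt0 x) x_k).
congr (sumn (take j _)).
exact: (insubdK x (is_composition_raise x_k (parts_seqP x))).
Qed.

Lemma psum_inj n p (x y : composition n p) :
  (forall k, sumn (take k x) = sumn (take k y)) -> x = y.
Proof.
by move=> xy; apply: dominance_anti; apply/andP; split; apply/dominanceE => k; rewrite xy.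
Qed.

Lemma psumS s k : k < size s -> sumn (take k.+1 s) = sumn (take k s) + nth 0 s k.
Proof. by move=> k_s; rewrite (take_nth 0 k_s) sumn_rcons. Qed.

Lemma lt_raise n p (x : composition n p) k : raisable p x k -> (x < raise x k)%O.
Proof.
move=> x_k; rewrite lt_neqAle; apply/andP; split; last first.
  by apply/dominanceE => j; rewrite psum_raise // leq_addr.
apply/eqP => /(congr1 (fun y : composition n p => sumn (take k.+1 y))).
by rewrite psum_raise // eqxx; lia.
Qed.

Lemma raise_inj n p (x : composition n p) k l : raisable p x k -> raisable p x l ->
  raise x k = raise x l -> k = l.
Proof.
move=> x_k x_l /(congr1 (fun y : composition n p => sumn (take k.+1 y))).
by rewrite !psum_raise // eqxx eqSS; case: eqP; lia.
Qed.

(* The first index where the partial sums of [x] and [y] differ carries a part smaller than [p]; the parts after it are 1 up to the next raisable index. *)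
Lemma exists_raisable n p (x y : composition n p) : 1 < p -> (x < y)%O ->
  exists2 k, raisable p x k & sumn (take k.+1 x) < sumn (take k.+1 y).
Proof.
move=> p_gt1 /[dup] /ltW /dominanceE xy x_lt_y.
have nth_le (z : composition n p) i : nth 0 z i <= p.
  have [z_i|i_z] := leqP (size z) i; first by rewrite nth_default.
  have /and3P[_ /allP z_parts _] := parts_seqP z.
  by have /andP[] := z_parts _ (mem_nth 0 i_z).
have nth_gt0 (z : composition n p) i : i < size z -> 0 < nth 0 z i.
  by move=> i_z; exact: (allP (composition_gt0 z) _ (mem_nth 0 i_z)).
have small k : sumn (take k x) < sumn (take k y) -> k < size x.
  move=> xy_k; rewrite ltnNge; apply/negP => /sumn_take_full x_k.
  by have := sumn_take_leq y k; lia.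
have [k [x_k xy_k]] : exists k, nth 0 x k < p /\ sumn (take k.+1 x) < sumn (take k.+1 y).
  have ex_k : exists k, sumn (take k x) < sumn (take k y).
    have [/existsP[k ?]|/existsPn no_k] :=
        boolP [exists k : 'I_n.+1, sumn (take k x) < sumn (take k y)].
      by exists k.
    suff xEy : x = y by rewrite xEy ltxx in x_lt_y.
    apply: psum_inj => k; apply/eqP; rewrite eqn_leq xy /=.
    have size_le (z : composition n p) : size z <= n.
      rewrite leqNgt; apply/negP => n_z.
      have: n < sumn (take n.+1 z).
        elim: n.+1 n_z => [|m IHm] // m_z.
        by rewrite psumS //; have := nth_gt0 z m m_z; have := IHm (ltnW m_z); lia.
      by rewrite ltnNge sumn_take_leq.
    have [n_k|k_n] := leqP n k.
      by rewrite !sumn_take_full //; apply: leq_trans n_k.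
    by rewrite leqNgt; exact: (no_k (Ordinal (ltnW k_n : k < n.+1))).
  case: (ex_minnP ex_k) => [[|k]]; first by rewrite !take0 ltnn.
  move=> xy_k k_min; exists k; split=> //.
  have Sk : sumn (take k y) <= sumn (take k x).
    by rewrite leqNgt; apply/negP => /k_min; rewrite ltnn.
  have kx := small _ xy_k; move: xy_k.
  rewrite (psumS (ltnW kx)).
  have [y_k|k_y] := leqP (size y) k.
    rewrite !(sumn_take_full (x := y)) //; last lia.
    by have := sumn_take_ltn (ltnW kx); move: Sk; rewrite (sumn_take_full y_k); lia.
  by rewrite psumS //; have := nth_le y k; lia.
(* If [k] is not raisable, the next part of [x] is a 1 that is not last, so the strict inequality
   persists at [k + 1]. *)
have [m] := ubnP (size x - k); elim: m k x_k xy_k => // m IHm k x_k xy_k k_m.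
have kx := small _ xy_k.
have [?|] := boolP (raisable p x k); first by exists k.
rewrite /raisable kx x_k /= negb_or -leqNgt => /andP[k_last xk1].
have kx2 : k.+2 < size x by lia.
apply: (IHm k.+1); [lia| |lia].
rewrite psumS //.
have [y_k|k_y] := leqP (size y) k.+1.
  have := sumn_take_ltn kx2; rewrite psumS // (sumn_take_full (x := y)) //; lia.
by rewrite (psumS k_y); have := nth_gt0 y _ k_y; lia.
Qed.

(** A raise adds 1 to a single partial sum, so nothing fits strictly between. Conversely, any [y]
    above [x] dominates some raise of [x], and a cover must equal it. *)
Lemma upper_coverP n p (x y : composition n p) : 1 < p ->
  reflect (exists2 k, raisable p x k & y = raise x k) (upper_cover x y).
Proof.
move=> p_gt1; apply: (iffP andP) => [[xy /forallP xy_cov]|[k x_k ->]].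
  have [k x_k xy_k] := exists_raisable p_gt1 xy; exists k => //.
  have : raise x k \in [set x; y].
    apply: (implyP (xy_cov _)); rewrite (ltW (lt_raise x_k)).
    apply/dominanceE => j; rewrite psum_raise //.
    by case: eqP => [->|_]; rewrite ?addn1 ?addn0 //; exact: (dominanceE _ _ (ltW xy)).
  by rewrite !inE => /orP[] /eqP // E; have := lt_raise x_k; rewrite E ltxx.
split; first exact: lt_raise.
apply/forallP => z; apply/implyP => /andP[/dominanceE xz /dominanceE zy].
have z_j j : j <> k.+1 -> sumn (take j z) = sumn (take j x).
  by move=> /eqP/negPf jk; have := xz j; have := zy j; rewrite psum_raise // jk; lia.
have := zy k.+1; rewrite psum_raise // eqxx addn1 leq_eqVlt ltnS => /orP[/eqP|] zk.
  suff -> : z = raise x k by rewrite !inE eqxx orbT.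
  apply: psum_inj => j; rewrite psum_raise //.
  by case: eqP => [->|/z_j]; rewrite ?addn1 ?addn0.
suff -> : z = x by rewrite !inE eqxx.
apply: psum_inj => j; case: (j =P k.+1) => [->|/z_j //].
by apply/eqP; rewrite eqn_leq zk xz.
Qed.

Lemma card_upper_cover n p (x : composition n p) : 1 < p ->
  #|[set y | upper_cover x y]| = num_raisable p x.
Proof.
move=> p_gt1; rewrite -(sum_raisable _ (leqnn (size x))).
have -> : [set y | upper_cover x y] =
    [set raise x k | k : 'I_(size x) in [set k : 'I_(size x) | raisable p x k]].
  apply/setP => y; rewrite !inE; apply/(upper_coverP _ _ p_gt1)/imsetP => [[k x_k ->]|[k]].
    have /andP[k_x _] := x_k.
    by exists (Ordinal (ltnW k_x)); rewrite ?inE.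
  by rewrite inE => x_k ->; exists k.
rewrite card_in_imset => [|k l]; last first.
  by rewrite !inE => x_k x_l /raise_inj-/(_ x_k x_l)/val_inj.
by rewrite -sum1dep_card big_mkcond; apply: eq_bigr => k _; case: ifP.
Qed.

(** * Meet-irreducible compositions *)

Definition mi_seq p a c b d e : seq nat :=
  nseq a p ++ c :: nseq b 1 ++ rcons (nseq d p) e.

Lemma num_raisable_nseq_rcons p d e : num_raisable p (rcons (nseq d p) e) = 0.
Proof. by elim: d => //= d ->; rewrite /raisable /= ltnn andbF. Qed.

(** Each part of [s] is followed by the last part or, by induction, by [p >= 2], so only being equal
    to [p] keeps it from being raisable. *)
Lemma num_raisable_eq0 p s e : 1 < p -> all (fun i => i <= p) (rcons s e) ->
  num_raisable p (rcons s e) = 0 -> s = nseq (size s) p.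
Proof.
move=> p_gt1; elim: s => [|a s IHs] //= /andP[a_p s_p].
move/eqP; rewrite addn_eq0 eqb0 => /andP[a_s /eqP /(IHs s_p) sE].
congr (_ :: _); last by [].
move: a_s; rewrite /raisable /= size_rcons sE.
by case: (size s) => [|m] /=; rewrite ?size_nseq; lia.
Qed.

Lemma num_raisable_mi_seq p a c b d e : 1 < p -> c < p ->
  num_raisable p (mi_seq p a c b d e) = 1.
Proof.
move=> p_gt1 c_p; rewrite /mi_seq; elim: a => [|a IHa] /=; last first.
  by rewrite /raisable /= ltnn andbF.
(* Here [c] is generalised: before a 1 that is not last it is not raisable, and removing it leaves
   the same shape with [c = 1]. *)
elim: b c c_p => [|b IHb] c c_p /=.
  rewrite num_raisable_nseq_rcons /raisable /= size_rcons size_nseq c_p.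
  by case: d => [|d] /=; lia.
by rewrite IHb // /raisable /= size_cat size_rcons; lia.
Qed.

Lemma num_raisable_eq1 p s : 1 < p -> all (fun i => 0 < i <= p) s ->
  num_raisable p s = 1 -> exists a c b d e, c < p /\ s = mi_seq p a c b d e.
Proof.
move=> p_gt1; elim: s => [|x s IHs] //= /andP[/andP[_ x_p] s_p].
(* A raisable first part uses up the count, so the tail has the form [p^d e]. *)
have [x_s|x_s] := boolP (raisable p (x :: s) 0).
  move=> /eqP; rewrite eqSS => /eqP.
  case/lastP: s s_p x_s {IHs} => [|s e] s_p x_s; first by move/and3P: x_s => [].
  have {}s_p : all (fun i => i <= p) (rcons s e).
    by apply: sub_all s_p => i /andP[].
  move/(num_raisable_eq0 p_gt1 s_p) => sE.
  exists 0, x, 0, (size s), e; split; last by rewrite /mi_seq /= -sE.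
  by have /and3P[] := x_s.
rewrite add0n => /(IHs s_p) [a [c [b [d [e [c_p sE]]]]]].
have [->|xp] := eqVneq x p.
  by exists a.+1, c, b, d, e; split=> //; rewrite sE.
have {}x_p : x < p by lia.
(* As [x < p] is not raisable, a 1 that is not last follows it: [a = 0], [c = 1], and this 1 joins
   the block of ones. *)
move: x_s; rewrite /raisable /= x_p sE /mi_seq.
case: a sE => [|a] sE /=; last by rewrite p_gt1 !orbT.
rewrite size_cat size_rcons !addnS negb_or -leqNgt /= => c_le1.
have c1 : c = 1.
  by move: s_p; rewrite sE /= => /andP[/andP[c_gt0 _] _]; lia.
by exists 0, x, b.+1, d, e; split=> //; rewrite c1.
Qed.

Lemma mi_seq_inj p a c b d e a' c' b' d' e' : 1 < p -> c < p -> c' < p ->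
  mi_seq p a c b d e = mi_seq p a' c' b' d' e' ->
  [/\ a = a', c = c', b = b', d = d' & e = e'].
Proof.
move=> p_gt1 c_p c'_p.
elim: a a' => [|a IHa] [|a'] /=; try by case; lia.
  case=> -> eq_bde; have := congr1 (last 0) eq_bde; rewrite !last_cat !last_rcons => ee.
  have bd : nseq b 1 ++ nseq d p = nseq b' 1 ++ nseq d' p.
    by move: eq_bde; rewrite -!rcons_cat => /rcons_inj[].
  (* Since [p] is not 1, counting ones gives [b]; the length then gives [d]. *)
  have := congr1 (count_mem 1) bd; have := congr1 size bd.
  rewrite !size_cat !size_nseq !count_cat !count_nseq /= (gtn_eqF p_gt1) /=.
  by move=> ? ?; split=> //; lia.
by case=> /IHa[-> -> -> -> ->].
Qed.

Lemma size_mi_seq p a c b d e : size (mi_seq p a c b d e) = (a + d) + b + 2.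
Proof. by rewrite /mi_seq size_cat /= size_cat size_rcons !size_nseq; lia. Qed.

Lemma is_composition_mi_seq n p a c b d e : 1 < p ->
  is_composition n p (mi_seq p a c b d e) =
  [&& 0 < c <= p, 0 < e <= p & p * (a + d) + c + b + e == n].
Proof.
move=> p_gt1; rewrite /is_composition size_mi_seq addnS /=.
rewrite /mi_seq all_cat /= all_cat all_rcons !all_nseq.
rewrite sumn_cat /= sumn_cat sumn_rcons !sumn_nseq.
have -> : 0 < p <= p by lia.
rewrite (ltnW p_gt1) /= !orbT !andbT /= -andbA.
by congr [&& _, _ & _ == n]; lia.
Qed.

Lemma mem_MI n p (x : composition n p) : 1 < p -> (x \in MI n p) = (num_raisable p x == 1).
Proof. by move=> p_gt1; rewrite inE card_upper_cover. Qed.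

(* Here [j.1.1.1 + 1] and [j.1.1.2 + 1] are the part in [1, p) and the last part, [j.1.2] is the number of other parts equal to [p], and [j.2] is the number of those at the beginning. *)
Definition mi_index n p := ('I_p.-1 * 'I_p * 'I_n.+1 * 'I_n.+1)%type.

(** The total [n] forces the number of ones; the truncated subtraction is exact on valid indices. *)
Definition mi_ones n p (c e s : nat) : nat := n - (c.+1 + e.+1 + p * s).

Definition mi_index_valid n p (j : mi_index n p) : bool :=
  (j.1.1.1.+1 + j.1.1.2.+1 + p * j.1.2 <= n) && (j.2 <= j.1.2).

Definition mi_seq_of_index n p (j : mi_index n p) : seq nat :=
  mi_seq p j.2 j.1.1.1.+1 (mi_ones n p j.1.1.1 j.1.1.2 j.1.2) (j.1.2 - j.2) j.1.1.2.+1.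

(** The size does not depend on how the [s] parts [p] are split between front and back, hence the
    weight [s.+1]. *)
Lemma sum_MI n p (F : nat -> nat) : 1 < p ->
  \sum_(x in MI n p) F (size x) =
  \sum_(c < p.-1) \sum_(e < p) \sum_(s < n.+1 | c.+1 + e.+1 + p * s <= n)
    s.+1 * F (s + mi_ones n p c e s + 2).
Proof.
move=> p_gt1.
have perm_MI : perm_eq [seq parts_seq x | x <- enum (MI n p)]
    [seq mi_seq_of_index j | j <- enum (@mi_index_valid n p)].
  apply: uniq_perm.
  - by rewrite map_inj_uniq ?enum_uniq //; exact: val_inj.
  - rewrite map_inj_in_uniq ?enum_uniq // => -[[[c e] s] a] [[[c' e'] s'] a'].
    rewrite !mem_enum => /andP[/= _ a_s] /andP[/= _ a_s'].
    case/mi_seq_inj => //=; [by rewrite -ltn_predRL ltn_ord..|].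
    move=> aa' [/val_inj->] _ ss' [/val_inj->].
    by congr (_, _, _, _); apply: val_inj => //=; lia.
  - move=> w; apply/mapP/mapP => [[x]|[[[[c e] s] a]]].
      rewrite mem_enum mem_MI // => /eqP x_1 ->.
      have xP := parts_seqP x; have /and3P[_ x_p _] := xP.
      have [a [c [b [d [e [c_p xE]]]]]] := num_raisable_eq1 p_gt1 x_p x_1.
      move: xP; rewrite xE is_composition_mi_seq // => /and3P[c_gt0 e_gt0 /eqP sumE].
      have c_lt : c.-1 < p.-1 by lia.
      have e_lt : e.-1 < p by lia.
      have s_lt : a + d < n.+1 by nia.
      have a_lt : a < n.+1 by lia.
      exists (Ordinal c_lt, Ordinal e_lt, Ordinal s_lt, Ordinal a_lt).
        by rewrite mem_enum; apply/andP => /=; lia.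
      rewrite /mi_seq_of_index /mi_ones /=; congr mi_seq; lia.
    rewrite mem_enum => /andP[/= sum_n a_s] ->.
    have c_p : c.+1 < p by rewrite -ltn_predRL ltn_ord.
    have wP : is_composition n p (mi_seq_of_index (c, e, s, a)).
      rewrite is_composition_mi_seq //= subnKC // /mi_ones; have := ltn_ord e; lia.
    exists (Composition wP) => //.
    by rewrite mem_enum mem_MI //= num_raisable_mi_seq.
transitivity (\sum_(j : mi_index n p | mi_index_valid j)
    F (j.1.2 + mi_ones n p j.1.1.1 j.1.1.2 j.1.2 + 2)).
  rewrite -big_enum -(big_map (@parts_seq n p) xpredT (fun w => F (size w))).
  rewrite (perm_big _ perm_MI) big_map.
  rewrite big_enum; apply: eq_bigr => -[[[c e] s] a] /andP[/= _ a_s].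
  by rewrite size_mi_seq subnKC.
(* The weight is unfolded into a sum over [a], so that both sides run over the same quadruples. *)
have card_le (s : 'I_n.+1) : s.+1 = \sum_(a < n.+1 | a <= s) 1.
  by rewrite -(big_ord_widen _ (fun=> 1) (ltn_ord s)) sum1_card card_ord.
under [RHS]eq_bigr => c _ do under eq_bigr => e _ do
  under eq_bigr => s _ do rewrite card_le big_distrl.
by rewrite pair_bigA pair_big_dep pair_big_dep /=; apply: eq_bigr => j _; rewrite mul1n.
Qed.

(** * The average number of parts *)

(** With weights [s + 1], the mean of [s] is [2 q / 3]: the source of the 3 in the limit. *)
Lemma sum_succ_mul q : 3 * (\sum_(s < q.+1) s.+1 * s) = 2 * q * (\sum_(s < q.+1) s.+1).
Proof.
have sum_succ m : 2 * (\sum_(s < m.+1) s.+1) = m.+1 * m.+2.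
  elim: m => [|m IHm]; first by rewrite big_ord1.
  by rewrite big_ord_recr mulnDr IHm /=; lia.
elim: q => [|q IHq]; first by rewrite !big_ord1.
rewrite big_ord_recr [in RHS]big_ord_recr mulnDr IHq /=.
move: (sum_succ q).
by set T := \sum_(s < q.+1) _; nia.
Qed.

(** Averages [(N + 2) - (p - 1) s]; the negative term stands on the left to avoid truncated
    subtraction. *)
Lemma sum_parts_fiber N p q : 0 < p -> p * q <= N ->
  3 * (\sum_(s < q.+1) s.+1 * (s + (N - p * s) + 2)) + 2 * p.-1 * q * (\sum_(s < q.+1) s.+1)
  = 3 * (N + 2) * (\sum_(s < q.+1) s.+1).
Proof.
move=> p_gt0 pq_N.
have -> : 2 * p.-1 * q * (\sum_(s < q.+1) s.+1) = 3 * (p.-1 * \sum_(s < q.+1) s.+1 * s).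
  by rewrite mulnCA sum_succ_mul; lia.
rewrite -mulnDr -mulnA; congr (3 * _); rewrite !big_distrr -big_split /=.
apply: eq_bigr => s _; have : p * s <= N by have := ltn_ord s; nia.
by case: p p_gt0 {pq_N} => // p _ /=; nia.
Qed.

(** Here [m] stands for [c + e]; the factor [3 * p] clears the denominators. *)
Lemma sum_parts_fiber_bounds n p m : 0 < p -> m <= 2 * p ->
  let T := \sum_(s < n.+1 | m + p * s <= n) s.+1 in
  let U := \sum_(s < n.+1 | m + p * s <= n) s.+1 * (s + (n - (m + p * s)) + 2) in
  3 * p * U <= ((p + 2) * n + 9 * p ^ 2) * T /\ (p + 2) * n * T <= 3 * p * U + 9 * p ^ 2 * T.
Proof.
move=> p_gt0 m_p.
have [n_m|m_n] := ltnP n m.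
  by rewrite !big_pred0 ?muln0 // => s; lia.
pose q := (n - m) %/ p.
have q_n : q < n.+1 by rewrite ltnS (leq_trans (leq_div _ _)) ?leq_subr.
have condE s : (m + p * s <= n) = (s < q.+1).
  by rewrite ltnS leq_divRL // mulnC; lia.
have eqE (F : nat -> nat) : \sum_(s < n.+1 | m + p * s <= n) F s = \sum_(s < q.+1) F s.
  by rewrite (big_ord_widen _ F q_n); apply: eq_bigl => s; exact: condE.
rewrite /= (eqE succn) (eqE (fun s => s.+1 * (s + (n - (m + p * s)) + 2))).
under eq_bigr => s _ do rewrite subnDA.
have nmE := divn_eq (n - m) p; have r_p := ltn_pmod (n - m) p_gt0.
rewrite -/q in nmE.
have := @sum_parts_fiber (n - m) p q p_gt0.
set U := \sum_(s < q.+1) _ * _; set T := \sum_(s < q.+1) _ => /(_ ltac:(lia)) UE.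
(* The extra factor [p] makes [p * q] appear, which is [n - m] up to a remainder below [p]. *)
have pUE : 3 * p * U + 2 * p.-1 * (p * q) * T = 3 * p * (n - m + 2) * T by nia.
have [k [r [pqE [nE r_lt]]]] : exists k r, p * q = k /\ n = k + r + m /\ r < p.
  by exists (p * q), ((n - m) %% p); split=> //; split; lia.
rewrite pqE in pUE.
have nmE2 : n - m = k + r by lia.
rewrite nmE2 in pUE.
rewrite nE; clear -p_gt0 m_p pUE r_lt.
(* The terms in [k] cancel, as [3 p = (p + 2) + 2 (p - 1)]; since [r < p] and [m <= 2 p], the rest
   is within [9 p^2]. *)
have h1 : 3 * p * (k + r + 2) <= (p + 2) * (k + r + m) + 9 * p ^ 2 + 2 * p.-1 * k by nia.
have h2 : (p + 2) * (k + r + m) + 2 * p.-1 * k <= 3 * p * (k + r + 2) + 9 * p ^ 2 by nia.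
have := leq_mul h1 (leqnn T); have := leq_mul h2 (leqnn T).
by rewrite !mulnDl; lia.
Qed.

(** The constants of the fiber bounds do not depend on [c] and [e], so these bounds add up. *)
Lemma sum_parts_MI_bounds n p : 1 < p ->
  3 * p * (\sum_(x in MI n p) parts x) <= ((p + 2) * n + 9 * p ^ 2) * #|MI n p| /\
  (p + 2) * n * #|MI n p| <= 3 * p * (\sum_(x in MI n p) parts x) + 9 * p ^ 2 * #|MI n p|.
Proof.
move=> p_gt1.
have -> : #|MI n p| = \sum_(c < p.-1) \sum_(e < p)
    \sum_(s < n.+1 | c.+1 + e.+1 + p * s <= n) s.+1.
  rewrite -sum1_card (@sum_MI n p (fun=> 1) p_gt1).
  by do 3![apply: eq_bigr => ? _]; rewrite muln1.
have -> := @sum_MI n p id p_gt1.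
rewrite !big_distrr -big_split /=; split; apply: leq_sum => c _;
  rewrite !big_distrr -?big_split /=; apply: leq_sum => e _.
  all: have m_p : c.+1 + e.+1 <= 2 * p by have := ltn_ord c; have := ltn_ord e; lia.
  all: by have [] := sum_parts_fiber_bounds n (ltnW p_gt1) m_p.
Qed.

Lemma card_MI_gt0 n p : 1 < p -> 1 < n -> 0 < #|MI n p|.
Proof.
move=> p_gt1 n_gt1; apply/card_gt0P.
(* The witness is [1^n]. *)
have wP : is_composition n p (mi_seq p 0 1 (n - 2) 0 1).
  by rewrite is_composition_mi_seq //; lia.
by exists (Composition wP); rewrite mem_MI //; apply/eqP; exact: num_raisable_mi_seq.
Qed.

(** * Passage to the limit *)

Local Open Scope classical_set_scope.
Local Open Scope ring_scope.

Theorem proposition3p2 (R : realType) (p : nat) (hp : (2 <= p)%N) :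
  (fun n : nat => #|MI n p|%:R^-1 * \sum_(x in MI n p) (parts x)%:R : R)
    ~_\oo
  (fun n : nat => (1 + 2 / p%:R) * (n%:R / 3) : R).
Proof.
have p_gt0 : (0 : R) < p%:R by rewrite ltr0n ltnW.
(* The constant is [9 p^2 / (3 p)]. *)
have avg_bound n : (1 < n)%N ->
    `|#|MI n p|%:R^-1 * \sum_(x in MI n p) (parts x)%:R - (1 + 2 / p%:R) * (n%:R / 3)|
      <= 3 * p%:R :> R.
  move=> n_gt1; have [upper lower] := sum_parts_MI_bounds n hp.
  have N_gt0 : (0 : R) < #|MI n p|%:R by rewrite ltr0n card_MI_gt0.
  rewrite -(ler_nat R) !(natrM, natrD, natrX) in upper.
  rewrite -(ler_nat R) !(natrM, natrD, natrX) in lower.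
  rewrite -natr_sum; move: upper lower N_gt0.
  set N : R := #|MI n p|%:R; set U : R := (\sum_(x in MI n p) _)%:R => upper lower N_gt0.
  have avgE : N^-1 * U - (1 + 2 / p%:R) * (n%:R / 3) =
      (3 * p%:R * U - (p%:R + 2) * n%:R * N) / (3 * p%:R * N).
    by field; rewrite !gt_eqF.
  rewrite avgE normrM normfV (gtr0_norm (_ : 0 < 3 * p%:R * N)); last first.
    by rewrite !mulr_gt0.
  rewrite ler_pdivrMr ?mulr_gt0 // ler_norml; apply/andP; split; lra.
apply/eqaddoP => eps eps_gt0.
near=> n.
have n_gt1 : (1 < n)%N by near: n; exact: nbhs_infty_gt.
apply: (le_trans (avg_bound n n_gt1)).
(* This threshold gives [3 p <= eps n / 3], and [1 + 2 / p >= 1] finishes. *)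
have n_large : 9 * p%:R / eps <= n%:R :> R by near: n; exact: nbhs_infty_ger.
rewrite ger0_norm; last by rewrite mulr_ge0 ?addr_ge0 ?divr_ge0 // ltW.
have n3_ge : 3 * p%:R <= eps * (n%:R / 3).
  by move: n_large; rewrite ler_pdivrMr //; lra.
apply: (le_trans n3_ge); rewrite ler_pM2l // ler_peMl ?divr_ge0 //.
by rewrite lerDl divr_ge0 // ltW.
Unshelve. all: by end_near.
Qed.
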